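(* Let $\tilde{\mathbf A}\in\mathbb R^{KN_r\times M}$ be the solution manifold matrix, $\mathbf A_{\rm p}\in\mathbb R^{KN_r\times M}$ its structured approximation, $\mathbf d\in\mathbb R^M$ the regularization vector, and $\tilde{\mathbf u}\in\mathbb R^M$ the truth weight vector, all as defined in the context. Define for $\mathbf u\in\mathbb R^M$ $$\eta(\mathbf u)=\|\tilde{\mathbf A}(\mathbf u-\tilde{\mathbf u})\|,\qquad \eta_{\rm t}(\mathbf u)=\|\mathbf A_{\rm p}(\mathbf u-\tilde{\mathbf u})\|,$$ and let $\kappa=\|\tilde{\mathbf A}-\mathbf A_{\rm p}\|_{\rm F}$. Let $d_{\min}$ be the smallest entry of $\mathbf d$ and assume $d_{\min}>0$. Let $M_{\rm c}<M$ be a positive integer and let $\mathbf u=[\omega_1,\dots,\omega_M]^T$ be a feasible point of the compressed training problem, i.e. there is an index set $I_c\subset\{1,\dots,M\}$ with $|I_c|\le M_{\rm c}$ such that $\omega_m\ge 0$ for $m\in I_c$ and $\omega_m=0$ for $m\notin I_c$. Assume that $|\mathbf d^T(\mathbf u-\tilde{\mathbf u})|\le\epsilon$ for some $\epsilon\ge 0$. Then the following two bounds hold: $$\eta(\mathbf u)\le \eta_{\rm t}(\mathbf u)+\kappa\,\|\mathbf u-\tilde{\mathbf u}\|\qquad\text{(a posteriori bound)},$$ $$\eta(\mathbf u)\le \eta_{\rm t}(\mathbf u)+\kappa\left(\frac{\sqrt{M_{\rm c}}}{d_{\min}}\bigl(\epsilon+\mathbf d^T\tilde{\mathbf u}\bigr)+\|\tilde{\mathbf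 u}\|\right)\qquad\text{(a priori bound)}.$$
   Context: Norms: $\|\cdot\|$ is the Euclidean norm of vectors and the spectral norm of matrices; $\|\cdot\|_{\rm F}$ is the Frobenius norm. Training data: $f$ is a nonlinearity, $x^1,\dots,x^K$ are snapshots in a finite-dimensional trial space of functions on a domain $\Omega$, $\varphi_{\rm r}^1,\dots,\varphi_{\rm r}^{N_r}$ are basis functions of a reduced test space, and $\beta_*^1,\dots,\beta_*^M$ are real-valued bilinear forms acting on pairs of functions on $\Omega$. Set $\mathbf a^{k,n}=[\beta_*^1(f(x^k),\varphi_{\rm r}^n),\dots,\beta_*^M(f(x^k),\varphi_{\rm r}^n)]^T\in\mathbb R^M$. The solution manifold matrix $\tilde{\mathbf A}\in\mathbb R^{KN_r\times M}$ has as rows the vectors $(\mathbf a^{k,n})^T$, ordered by $k=1,\dots,K$ and, within each $k$, by $n=1,\dots,N_r$. The vector $\mathbf d=[\beta_*^1(1,1),\dots,\beta_*^M(1,1)]^T$, where $1$ is the constant function. The truth weight vector $\tilde{\mathbf u}=[\tilde\omega_1,\dots,\tilde\omega_M]^T\in\mathbb R^M$ is a given vector of weights. Training problems: the uncompressed problem minimizes $\eta(\mathbf u)^2+(\mathbf d^T(\mathbf u-\tilde{\mathbf u}))^2$, and the compressed problem minimizes $\eta_{\rm t}(\mathbf u)^2+(\mathbf d^T(\mathbf u-\tilde{\mathbf u}))^2$, both over index sets $I_c\subset\{1,\dots,M\}$ with $|I_c|\le M_{\rm c}$ and $\mathbf u=[\omega_1,\dots,\omega_M]^T$ with $\omega_m\ge0$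 for $m\in I_c$ and $\omega_m=0$ for $m\notin I_c$. Structured approximation: let $\tilde{\mathbf C}\in\mathbb R^{N_rM\times K}$ be the reshaping of $\tilde{\mathbf A}$ whose $(n,k)$ block ($n=1,\dots,N_r$, $k=1,\dots,K$) is the column vector $\mathbf a^{k,n}$. It is given in factorized form $\tilde{\mathbf C}=\mathbf N\hat{\mathbf G}$ with $\mathbf N\in\mathbb R^{N_rM\times M_J}$ of full column rank and $\hat{\mathbf G}\in\mathbb R^{M_J\times K}$. Let $K_{\rm t}<\operatorname{rank}(\tilde{\mathbf C})$ be a positive integer, $\mathbf N=\mathbf Q\mathbf R$ a (thin) QR factorization, and $\mathbf U_1^L\boldsymbol\Sigma_1\mathbf U_1^R$ the truncated singular value decomposition of $\mathbf R\hat{\mathbf G}$ of rank $K_{\rm t}$, with $\mathbf U_1^L\in\mathbb R^{M_J\times K_{\rm t}}$, $\boldsymbol\Sigma_1\in\mathbb R^{K_{\rm t}\times K_{\rm t}}$, and $\mathbf U_1^R\in\mathbb R^{K_{\rm t}\times K}$ (the rows of $\mathbf U_1^R$ being right singular vectors). Put $\mathbf G_t^*=\mathbf R^{-1}\mathbf U_1^L\boldsymbol\Sigma_1$ and $\mathbf G_p^*=\mathbf G_t^*\mathbf U_1^R$, so that $\mathbf G_p^*$ minimizes $\|\tilde{\mathbf C}-\mathbf N\mathbf G\|_{\rm F}$ over all $\mathbf G$ of rank at most $K_{\rm t}$. The matrix $\mathbf A_{\rm p}$ is obtained from $\mathbf N\mathbf G_p^*$ by the same reshaping that takes $\tilde{\mathbf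 C}$ to $\tilde{\mathbf A}$. The compressed matrix $\mathbf A_{\rm t}\in\mathbb R^{K_{\rm t}N_r\times M}$ is the analogous reshaping of $\mathbf N\mathbf G_t^*\in\mathbb R^{N_rM\times K_{\rm t}}$; one has $\mathbf A_{\rm p}=\tilde{\mathbf Q}\mathbf A_{\rm t}$ with $\tilde{\mathbf Q}\in\mathbb R^{KN_r\times K_{\rm t}N_r}$ having orthonormal columns, so $\eta_{\rm t}(\mathbf u)=\|\mathbf A_{\rm t}(\mathbf u-\tilde{\mathbf u})\|$. Moreover $\kappa=\|\tilde{\mathbf A}-\mathbf A_{\rm p}\|_{\rm F}=\|\tilde{\mathbf C}-\mathbf N\mathbf G_p^*\|_{\rm F}=\sqrt{\sum_{i>K_{\rm t}}\sigma_i^2}$, where $\sigma_1\ge\sigma_2\ge\dots\ge0$ are the singular values of $\mathbf R\hat{\mathbf G}$. *)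

(* Defs.v *)
From mathcomp Require Export all_boot all_order all_algebra.
From mathcomp Require Export all_classical all_reals.
From mathcomp Require Export mxtens.

Set Implicit Arguments.
Unset Strict Implicit.
Unset Printing Implicit Defensive.

Import Order.TTheory GRing.Theory Num.Theory.
Local Open Scope ring_scope.

(* Real functions on Omega, with the pointwise R-module structure; [R^o] (R as
   a module over itself) is what lets [a *: g] be inferred. *)
Notation rfun Omega R := (Omega -> R^o).

Section FunctionSpaces.
Variables (R : realType) (Omega : Type).
Implicit Types (F X : {pred rfun Omega R}).

Definition finite_dimensional X : Prop :=
  exists (n : nat) (e : 'I_n -> rfun Omega R),
    {in X, forall g, exists c : 'I_n -> R, g = \sum_i c i *: e i}.

Definition linearly_independent n (e : 'I_n -> rfun Omega R) : Prop :=
  forall c : 'I_n -> R, \sum_i c i *: e i = 0 -> forall i, c i = 0.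

(* Bilinearity is only required on F: a form such as an integral over a part of
   Omega does not make sense for arbitrary functions. *)
Definition bilinear_form_on F (b : rfun Omega R -> rfun Omega R -> R) : Prop :=
  (forall a : R, {in F & &, forall g g' h,
     b (a *: g + g') h = a * b g h + b g' h}) /\
  (forall a : R, {in F & &, forall g h h',
     b g (a *: h + h') = a * b g h + b g h'}).

End FunctionSpaces.

Section Norms.
Variable R : realType.

(* The norm that MathComp-Analysis puts on matrices is the max norm, hence these
   definitions. *)
Definition eucl_norm n (v : 'cV[R]_n) : R := Num.sqrt (\sum_i v i 0 ^+ 2).

Definition frob_norm m n (A : 'M[R]_(m, n)) : R :=
  Num.sqrt (\sum_i \sum_j A i j ^+ 2).

Definition dotv n (v w : 'cV[R]_n) : R := (v^T *m w) 0 0.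

End Norms.

Section Factorizations.
Variable R : realType.

(* [is_trig_mx] is lower triangularity. *)
Definition thin_qr m n (A Q : 'M[R]_(m, n)) (T : 'M[R]_n) : Prop :=
  [/\ A = Q *m T, Q^T *m Q = 1%:M & is_trig_mx T^T].

Definition rect_diag m n (s : nat -> R) : 'M[R]_(m, n) :=
  \matrix_(i, j) (s i *+ (i == j :> nat)).

(* The singular values are the s i with i < minn m n (counted from 0); the rows
   of V are the right singular vectors. *)
Definition is_svd m n (A : 'M[R]_(m, n))
    (U : 'M[R]_m) (s : nat -> R) (V : 'M[R]_n) : Prop :=
  [/\ A = U *m rect_diag m n s *m V, U^T *m U = 1%:M, V *m V^T = 1%:M,
      forall i, 0 <= s i & forall i j, (i <= j)%N -> s j <= s i].

(* For k <= minn m n, multiplying by [pid_mx k] on the right (left) selects the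
   first k columns (rows). *)
Definition truncated_svd m n (A : 'M[R]_(m, n)) k
    (U1 : 'M[R]_(m, k)) (S1 : 'M[R]_k) (V1 : 'M[R]_(k, n)) : Prop :=
  exists (U : 'M[R]_m) (s : nat -> R) (V : 'M[R]_n),
    [/\ is_svd A U s V, U1 = U *m pid_mx k, S1 = rect_diag k k s
      & V1 = pid_mx k *m V].

End Factorizations.

Section Reshaping.
Variable R : realType.

(* [mxtens_index (i, j)] with i : 'I_m and j : 'I_n is the index i * n + j in
   'I_(m * n), and [mxtens_unindex] is its inverse. *)

(* Row (k, n) of A becomes the (n, k) block of the result. *)
Definition to_blocks K Nr M (A : 'M[R]_(K * Nr, M)) : 'M[R]_(Nr * M, K) :=
  \matrix_(p, k) let nm := mxtens_unindex p in
    A (mxtens_index (k, nm.1)) nm.2.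

Definition of_blocks K Nr M (C : 'M[R]_(Nr * M, K)) : 'M[R]_(K * Nr, M) :=
  \matrix_(q, m) let kn := mxtens_unindex q in
    C (mxtens_index (kn.2, m)) kn.1.

Lemma to_blocksK K Nr M : cancel (@to_blocks K Nr M) (@of_blocks K Nr M).
Proof.
move=> A; apply/matrixP => q m; case: (mxtens_indexP q) => k n.
by rewrite mxE mxtens_indexK [LHS]mxE mxtens_indexK.
Qed.

Lemma of_blocksK K Nr M : cancel (@of_blocks K Nr M) (@to_blocks K Nr M).
Proof.
move=> C; apply/matrixP => p k; case: (mxtens_indexP p) => n m.
by rewrite mxE mxtens_indexK [LHS]mxE mxtens_indexK.
Qed.

End Reshaping.

Section Training.
Variables (R : realType) (Omega : Type) (K Nr M : nat).

Definition solution_manifold_mx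
    (beta : 'I_M -> rfun Omega R -> rfun Omega R -> R)
    (f : rfun Omega R -> rfun Omega R)
    (x : 'I_K -> rfun Omega R) (phi : 'I_Nr -> rfun Omega R) :
    'M[R]_(K * Nr, M) :=
  \matrix_(q, m) let kn := mxtens_unindex q in beta m (f (x kn.1)) (phi kn.2).

Definition regularization_vec
    (beta : 'I_M -> rfun Omega R -> rfun Omega R -> R) : 'cV[R]_M :=
  \col_m beta m (cst 1) (cst 1).

Definition structured_approx J Kt (N : 'M[R]_(Nr * M, J)) (T : 'M[R]_J)
    (U1 : 'M[R]_(J, Kt)) (S1 : 'M[R]_Kt) (V1 : 'M[R]_(Kt, K)) :
    'M[R]_(K * Nr, M) :=
  let Gt := invmx T *m U1 *m S1 in
  let Gp := Gt *m V1 in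
  of_blocks (N *m Gp).

Definition feasible (Mc : nat) (u : 'cV[R]_M) : Prop :=
  exists I : {set 'I_M}, [/\ (#|I| <= Mc)%N,
    forall m, m \in I -> 0 <= u m 0 & forall m, m \notin I -> u m 0 = 0].

Definition smallest_entry (d : 'cV[R]_M) (c : R) : Prop :=
  (exists m, d m 0 = c) /\ (forall m, c <= d m 0).

End Training.

(* Main.v *)
Require Import Defs.
From mathcomp Require Import ring lra.

(** Write [v := u - ut]. The a posteriori bound is the triangle inequality for
    [A *m v = Ap *m v + (A - Ap) *m v], together with the fact that the
    Frobenius norm of a matrix bounds its Euclidean operator norm
    ([eucl_norm_mulmx_le]); both rest on the Cauchy-Schwarz inequality
    ([cauchy_schwarz_sum], [dotv_le_eucl_norm]).

    The a priori bound then only needs a bound on [eucl_norm u]. A feasible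
    vector has nonnegative entries, so its Euclidean norm is at most the sum of
    its entries, and since every entry of [d] is at least [dmin], that sum is at
    most [dotv d u / dmin] ([scaled_eucl_norm_le_dotv]). The constraint on
    [dotv d (u - ut)] gives [dotv d u <= eps + dotv d ut], and the factor
    [Num.sqrt Mc%:R >= 1] only weakens the resulting estimate. *)

Set Implicit Arguments.
Unset Strict Implicit.
Unset Printing Implicit Defensive.

Import Order.TTheory GRing.Theory Num.Theory.
Local Open Scope ring_scope.

(** Lagrange's identity: twice the gap between the two sides is
    [\sum_i \sum_j (a i * b j - a j * b i) ^+ 2]. *)
Lemma cauchy_schwarz_sum (R : realDomainType) (I : finType) (a b : I -> R) :
  (\sum_i a i * b i) ^+ 2 <= (\sum_i a i ^+ 2) * (\sum_i b i ^+ 2).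
Proof.
set S := \sum_i a i * b i; set A := \sum_i a i ^+ 2; set B := \sum_i b i ^+ 2.
have lagrange : \sum_i \sum_j (a i * b j - a j * b i) ^+ 2
    = A * B *+ 2 - S ^+ 2 *+ 2.
  transitivity (\sum_i (a i ^+ 2 * B + b i ^+ 2 * A - (a i * b i) * S *+ 2)).
    apply: eq_bigr => i _.
    rewrite !mulr_sumr -sumrMnl -sumrN -!big_split /=.
    by apply: eq_bigr => j _; ring.
  rewrite !big_split /= sumrN sumrMnl -!mulr_suml -/A -/B -/S.
  by ring.
have : 0 <= A * B *+ 2 - S ^+ 2 *+ 2.
  by rewrite -lagrange; do 2!apply: sumr_ge0 => ? _; apply: sqr_ge0.
by lra.
Qed.

Section Norms.
Variable R : realType.

Lemma eucl_norm_ge0 n (v : 'cV[R]_n) : 0 <= eucl_norm v.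
Proof. exact: sqrtr_ge0. Qed.

Lemma sqr_eucl_norm n (v : 'cV[R]_n) : eucl_norm v ^+ 2 = \sum_i v i 0 ^+ 2.
Proof. by rewrite sqr_sqrtr // sumr_ge0 // => i _; apply: sqr_ge0. Qed.

Lemma frob_norm_ge0 m n (B : 'M[R]_(m, n)) : 0 <= frob_norm B.
Proof. exact: sqrtr_ge0. Qed.

Lemma sqr_frob_norm m n (B : 'M[R]_(m, n)) :
  frob_norm B ^+ 2 = \sum_i \sum_j B i j ^+ 2.
Proof. by rewrite sqr_sqrtr //; do 2!apply: sumr_ge0 => ? _; apply: sqr_ge0. Qed.

Lemma dotvE n (v w : 'cV[R]_n) : dotv v w = \sum_i v i 0 * w i 0.
Proof. by rewrite /dotv mxE; apply: eq_bigr => i _; rewrite mxE. Qed.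

Lemma dotvBr n (d v w : 'cV[R]_n) : dotv d (v - w) = dotv d v - dotv d w.
Proof. by rewrite /dotv mulmxBr !mxE. Qed.

Lemma dotv_le_eucl_norm n (v w : 'cV[R]_n) :
  dotv v w <= eucl_norm v * eucl_norm w.
Proof.
apply: le_trans (ler_norm _) _.
rewrite -(ler_pXn2r (n := 2)) ?nnegrE ?mulr_ge0 ?eucl_norm_ge0 //.
by rewrite real_normK ?num_real // exprMn !sqr_eucl_norm dotvE cauchy_schwarz_sum.
Qed.

Lemma ler_eucl_normD n (v w : 'cV[R]_n) :
  eucl_norm (v + w) <= eucl_norm v + eucl_norm w.
Proof.
rewrite -(ler_pXn2r (n := 2)) ?nnegrE ?addr_ge0 ?eucl_norm_ge0 //.
have -> : eucl_norm (v + w) ^+ 2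
    = eucl_norm v ^+ 2 + dotv v w *+ 2 + eucl_norm w ^+ 2.
  rewrite !sqr_eucl_norm dotvE -sumrMnl -!big_split /=.
  by apply: eq_bigr => i _; rewrite mxE; ring.
by rewrite sqrrD lerD2r lerD2l lerMn2r dotv_le_eucl_norm.
Qed.

Lemma eucl_normN n (v : 'cV[R]_n) : eucl_norm (- v) = eucl_norm v.
Proof. by congr Num.sqrt; apply: eq_bigr => i _; rewrite mxE sqrrN. Qed.

(** Cauchy-Schwarz applied to each row of [B]. *)
Lemma eucl_norm_mulmx_le m n (B : 'M[R]_(m, n)) (v : 'cV[R]_n) :
  eucl_norm (B *m v) <= frob_norm B * eucl_norm v.
Proof.
rewrite -(ler_pXn2r (n := 2)) ?nnegrE ?mulr_ge0 ?eucl_norm_ge0 ?frob_norm_ge0 //.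
rewrite exprMn !sqr_eucl_norm sqr_frob_norm mulr_suml.
by apply: ler_sum => i _; rewrite mxE cauchy_schwarz_sum.
Qed.

(** Since the entries of [u] are nonnegative, the square of their sum contains
    all the squares [u i 0 ^+ 2], so the sum bounds [eucl_norm u]; weighting the
    entries by [d] instead of [c] can only increase the sum. *)
Lemma scaled_eucl_norm_le_dotv n (c : R) (d u : 'cV[R]_n) :
    0 <= c -> (forall i, c <= d i 0) -> (forall i, 0 <= u i 0) ->
  c * eucl_norm u <= dotv d u.
Proof.
move=> c0 cd u0; apply: (@le_trans _ _ (c * \sum_i u i 0)).
  rewrite ler_wpM2l // -(ler_pXn2r (n := 2)) ?nnegrE ?eucl_norm_ge0 ?sumr_ge0 //.
  rewrite sqr_eucl_norm expr2 mulr_suml; apply: ler_sum => i _.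
  by rewrite expr2 ler_wpM2l // (bigD1 i) //= lerDl sumr_ge0.
by rewrite dotvE mulr_sumr; apply: ler_sum => i _; rewrite ler_wpM2r.
Qed.

Lemma feasible_ge0 n k (u : 'cV[R]_n) : feasible k u -> forall i, 0 <= u i 0.
Proof.
by case=> I [_ uI uNI] i; case: (boolP (i \in I)) => [/uI|/uNI ->].
Qed.

End Norms.

Theorem theorem6p1
    (R : realType) (Omega : Type) (K Nr M : nat)
    (* training data *)
    (F X : {pred rfun Omega R})
    (f : rfun Omega R -> rfun Omega R)
    (x : 'I_K -> rfun Omega R)
    (phi : 'I_Nr -> rfun Omega R)
    (beta : 'I_M -> rfun Omega R -> rfun Omega R -> R)
    (hF : GRing.submod_closed F) (h1 : (cst 1 : rfun Omega R) \in F)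
    (hX : GRing.submod_closed X) (hXfin : finite_dimensional X)
    (hx : forall k, x k \in X) (hfx : forall k, f (x k) \in F)
    (hphi : forall n, phi n \in F) (hphi_free : linearly_independent phi)
    (hbeta : forall m, bilinear_form_on F (beta m))
    (* structured approximation *)
    (J Kt : nat)
    (N : 'M[R]_(Nr * M, J)) (G : 'M[R]_(J, K))
    (Q : 'M[R]_(Nr * M, J)) (T : 'M[R]_J)
    (U1 : 'M[R]_(J, Kt)) (S1 : 'M[R]_Kt) (V1 : 'M[R]_(Kt, K))
    (* truth weights, cardinality bound, candidate weights *)
    (ut : 'cV[R]_M) (Mc : nat) (u : 'cV[R]_M) (dmin eps : R) :
  let A := solution_manifold_mx beta f x phi in
  let C := to_blocks A in
  let d := regularization_vec beta in
  let Ap := structured_approx N T U1 S1 V1 in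
  let eta := fun v : 'cV[R]_M => eucl_norm (A *m (v - ut)) in
  let eta_t := fun v : 'cV[R]_M => eucl_norm (Ap *m (v - ut)) in
  let kappa := frob_norm (A - Ap) in
  C = N *m G ->
  \rank N = J ->
  (0 < Kt)%N -> (Kt < \rank C)%N ->
  thin_qr N Q T ->
  truncated_svd (T *m G) U1 S1 V1 ->
  smallest_entry d dmin -> 0 < dmin ->
  (0 < Mc)%N -> (Mc < M)%N ->
  feasible Mc u ->
  0 <= eps -> `|dotv d (u - ut)| <= eps ->
  eta u <= eta_t u + kappa * eucl_norm (u - ut)
  /\ eta u <= eta_t u
       + kappa * (Num.sqrt Mc%:R / dmin * (eps + dotv d ut) + eucl_norm ut).
Proof.
move=> A C d Ap eta eta_t kappa _ _ _ _ _ _ [_ dmin_le] dmin0 Mc0 _ /feasible_ge0 u0.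
move=> eps0 constr.
have posteriori : eta u <= eta_t u + kappa * eucl_norm (u - ut).
  have -> : eta u = eucl_norm (Ap *m (u - ut) + (A - Ap) *m (u - ut)).
    by rewrite -mulmxDl addrC subrK.
  by apply: (le_trans (ler_eucl_normD _ _)); rewrite lerD2l eucl_norm_mulmx_le.
split=> //; apply: (le_trans posteriori).
rewrite lerD2l ler_wpM2l ?frob_norm_ge0 //.
apply: (le_trans (ler_eucl_normD _ _)); rewrite eucl_normN lerD2r.
have du_le : dotv d u <= eps + dotv d ut.
  by rewrite -lerBlDr -dotvBr (le_trans (ler_norm _)).
have norm_le : eucl_norm u <= (eps + dotv d ut) / dmin.
  rewrite ler_pdivlMr // mulrC; apply: (le_trans _ du_le).
  by apply: scaled_eucl_norm_le_dotv => //; apply: ltW.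
have sqrtMc_ge1 : 1 <= Num.sqrt Mc%:R :> R.
  by rewrite -[leLHS]sqrtr1 ler_wsqrtr // ler1n.
apply: (le_trans norm_le); rewrite mulrAC -mulrA ler_peMl //.
(* The bound on [eucl_norm u] itself shows that this quotient is nonnegative. *)
by apply: (le_trans _ norm_le); apply: eucl_norm_ge0.
Qed.
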